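(* Let $T_t(z)=it\tan z$, $t>0$. As $t$ increases through $1$, $0$ becomes a repelling fixed point of $T_t$ and a period $4$ attracting cycle forms near $0$. This attracting cycle persists for all $t\in(1,\pi/2)$: for every $t\in(1,\pi/2)$, $0$ is a repelling fixed point of $T_t$ and $T_t$ has an attracting cycle of period $4$, which converges to $0$ as $t\to1^+$.
   Context: A period $n$ cycle of $T_t$ is a set of $n$ distinct points $z_1,\dots,z_n$ with $T_t(z_i)=z_{i+1}$ (indices mod $n$); its multiplier is $(T_t^n)'(z_1)$, and it is attracting (repelling) if the multiplier has absolute value less than (greater than) $1$. *)

(* Defs.v *)
From Stdlib Require Import Reals.
From Coquelicot Require Import Coquelicot.
Open Scope C_scope.

Definition Cexp (z : C) : C :=
  (exp (Re z) * cos (Im z), exp (Re z) * sin (Im z))%R.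

Definition Ccos (z : C) : C := (Cexp (Ci * z) + Cexp (- (Ci * z))) / 2.

Definition Csin (z : C) : C := (Cexp (Ci * z) - Cexp (- (Ci * z))) / (2 * Ci).

(* Division on [C] is total, so [Ctan] takes a junk value at the zeros of
   [Ccos], which are the poles of the tangent; see [is_cycle]. *)
Definition Ctan (z : C) : C := Csin z / Ccos z.

Definition T (t : R) (z : C) : C := Ci * RtoC t * Ctan z.

(* A cycle is listed as [z 0, ..., z (n-1)]; values of [z] from [n] on are
   irrelevant.  No point of a cycle may be a pole of [T t]. *)
Definition is_cycle (t : R) (n : nat) (z : nat -> C) : Prop :=
  (0 < n)%nat /\
  (forall i j : nat, (i < n)%nat -> (j < n)%nat -> z i = z j -> i = j) /\
  (forall i : nat, (i < n)%nat ->
     Ccos (z i) <> 0 /\ T t (z i) = z (Nat.modulo (S i) n)).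

(* Complex derivative of the [n]-th iterate.  It is a relation so that the
   derivative is required to exist wherever a multiplier is mentioned. *)
Definition is_multiplier (t : R) (n : nat) (z : nat -> C) (m : C) : Prop :=
  is_derive (K := C_AbsRing) (V := C_NormedModule)
    (Nat.iter n (T t)) (z 0%nat) m.

Definition is_attracting_cycle (t : R) (n : nat) (z : nat -> C) : Prop :=
  is_cycle t n z /\
  exists m : C, is_multiplier t n z m /\ (Cmod m < 1)%R.

Definition is_repelling_cycle (t : R) (n : nat) (z : nat -> C) : Prop :=
  is_cycle t n z /\
  exists m : C, is_multiplier t n z m /\ (1 < Cmod m)%R.

Definition is_repelling_fixed_point (t : R) (p : C) : Prop :=
  is_repelling_cycle t 1 (fun _ : nat => p).

(* Main.v *)
Require Import Defs.
From Stdlib Require Import Reals.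
From Coquelicot Require Import Coquelicot.
From Stdlib Require Import Lra Lia ClassicalEpsilon.

(** [T_t] maps [x] to [i t tan x] and [i y] to [- t tanh y], so a fixed point
    [x > 0] of the real map [g_t x = t tanh (t tan x)] gives the 4-cycle
    [x, i t tan x, -x, -i t tan x], with multiplier [g_t'(x)^2].  At a fixed point
    [g_t'(x) = (t^2 - x^2) / cos^2 x], so the cycle attracts iff
    [t^2 < x^2 + cos^2 x].  The function [artanh (x/t) - t tan x] vanishes at [0],
    decreases while [x^2 + cos^2 x < t^2] and increases afterwards; hence for
    [1 < t < PI/2] it has exactly one zero on [(0, t)], in the increasing part.
    The sign of [g_t u - u] on either side of that zero traps it, which gives
    continuity in [t] and the limit at [1]. *)

Local Open Scope R_scope.

(** * Fixed points of [x -> t tanh (t tan x)] *)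

Lemma tanh_exp (y : R) : tanh y = 1 - 2 / (exp (2 * y) + 1).
Proof.
unfold tanh, sinh, cosh.
replace (2 * y) with (y + y) by ring; rewrite exp_plus, exp_Ropp.
pose proof (exp_pos y); field; repeat split; nra.
Qed.

Lemma tanh_lt_1 (y : R) : tanh y < 1.
Proof.
rewrite tanh_exp; pose proof (exp_pos (2 * y)).
assert (0 < 2 / (exp (2 * y) + 1)) by (apply Rdiv_lt_0_compat; lra); lra.
Qed.

Lemma tanh_increasing (a b : R) : a < b -> tanh a < tanh b.
Proof.
intros H; rewrite !tanh_exp; pose proof (exp_pos (2 * a)).
assert (exp (2 * a) < exp (2 * b)) by (apply exp_increasing; lra).
assert (/ (exp (2 * b) + 1) < / (exp (2 * a) + 1)) by (apply Rinv_lt_contravar; nra).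
unfold Rdiv; lra.
Qed.

(** Lets cosh^2 at the imaginary points of the cycle be traded for t^2 - x^2 in the multiplier. *)
Lemma cosh_sqr_tanh (y : R) : cosh y * cosh y * (1 - tanh y * tanh y) = 1.
Proof.
unfold tanh, sinh, cosh; rewrite exp_Ropp.
pose proof (exp_pos y); field; repeat split; nra.
Qed.

Lemma tanh_opp (y : R) : tanh (- y) = - tanh y.
Proof.
rewrite !tanh_exp; replace (2 * - y) with (- (2 * y)) by ring; rewrite exp_Ropp.
pose proof (exp_pos (2 * y)); field; repeat split; lra.
Qed.

Lemma cosh_pos (y : R) : 0 < cosh y.
Proof. unfold cosh; pose proof (exp_pos y); pose proof (exp_pos (- y)); lra. Qed.

Lemma cosh_opp (y : R) : cosh (- y) = cosh y.
Proof. unfold cosh; rewrite Ropp_involutive; field. Qed.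

(** The derivative 2x - sin 2x is positive for x > 0. Hence the sign of x^2 + cos^2 x - t^2, which
    governs the slope of [gap], changes at most once. *)
Lemma sqr_plus_cos_sqr_increasing (a b : R) : 0 <= a < b ->
  a * a + cos a * cos a < b * b + cos b * cos b.
Proof.
intros [Ha Hab].
destruct (MVT_cor2 (fun x => x * x + cos x * cos x) (fun x => 2 * x - sin (2 * x)) a b Hab)
  as (c & E & Hc).
- intros c Hc; apply is_derive_Reals; auto_derive; auto; rewrite sin_2a; ring.
- assert (sin (2 * c) < 2 * c) by (apply sin_lt_x; lra); nra.
Qed.

(** * Sign and monotonicity of artanh(x/t) - t tan x *)

(* The sign of [gap t x] is opposite to that of [t * tanh (t * tan x) - x], and
   its derivative [t / (t^2 - x^2) - t / cos^2 x] has an explicit sign change. *)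
Definition gap (t x : R) : R := (ln (t + x) - ln (t - x)) / 2 - t * tan x.

Lemma gap_0 (t : R) : gap t 0 = 0.
Proof. unfold gap; rewrite Rplus_0_r, Rminus_0_r, tan_0; field. Qed.

(** The argument of tanh is artanh(x/t): the exponential of its double is (t + x)/(t - x). *)
Lemma tanh_gap (t x : R) : 0 <= x < t ->
  t * tanh (gap t x + t * tan x) = x.
Proof.
intros Hx; rewrite tanh_exp; unfold gap.
replace (2 * ((ln (t + x) - ln (t - x)) / 2 - t * tan x + t * tan x))
  with (ln (t + x) + - ln (t - x)) by field.
rewrite exp_plus, exp_Ropp, !exp_ln by lra; field; lra.
Qed.

Lemma gap_neg (t x : R) : 0 <= x < t -> gap t x < 0 -> x < t * tanh (t * tan x).
Proof.
intros Hx H; rewrite <- (tanh_gap t x Hx) at 1.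
apply Rmult_lt_compat_l; [lra | apply tanh_increasing; lra].
Qed.

Lemma gap_pos (t x : R) : 0 <= x < t -> 0 < gap t x -> t * tanh (t * tan x) < x.
Proof.
intros Hx H; rewrite <- (tanh_gap t x Hx) at 2.
apply Rmult_lt_compat_l; [lra | apply tanh_increasing; lra].
Qed.

Lemma gap_root (t x : R) : 0 <= x < t -> t * tanh (t * tan x) = x -> gap t x = 0.
Proof.
intros Hx H; destruct (Rtotal_order (gap t x) 0) as [L | [L | L]]; auto.
- apply gap_neg in L; lra.
- apply gap_pos in L; lra.
Qed.

Lemma gap_MVT (t a b : R) : 0 <= a < b -> b < t < PI / 2 ->
  exists c, a < c < b /\
    gap t b - gap t a = t * (/ (t * t - c * c) - / (cos c * cos c)) * (b - a).
Proof.
intros Ha Hb.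
destruct (MVT_cor2 (gap t) (fun c => t * (/ (t * t - c * c) - / (cos c * cos c))) a b ltac:(lra))
  as (c & E & Hc); [|now exists c].
intros c Hc; apply is_derive_Reals; unfold gap, tan.
assert (0 < cos c) by (apply cos_gt_0; lra).
assert (0 < t * t - c * c) by nra.
auto_derive; [repeat split; lra|].
(* Writing 1 as sin^2 + cos^2 matches the derivative of sin/cos produced by [auto_derive]. *)
replace (t * (/ (t * t - c * c) - / (cos c * cos c)))
  with (t * (/ (t * t - c * c) - (sin c * sin c + cos c * cos c) / (cos c * cos c))).
- field; repeat split; nra.
- pose proof (sin2_cos2 c) as E; unfold Rsqr in E; rewrite E; field; repeat split; lra.
Qed.

(** A condition at the left end [a] controls the whole interval because x^2 + cos^2 x increases;
    [gap_decreasing] uses the right end likewise. *)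
Lemma gap_increasing (t a b : R) : 0 <= a < b -> b < t < PI / 2 ->
  t * t <= a * a + cos a * cos a -> gap t a < gap t b.
Proof.
intros Ha Hb Hq; destruct (gap_MVT t a b Ha Hb) as (c & Hc & E).
pose proof (sqr_plus_cos_sqr_increasing a c ltac:(lra)).
assert (/ (cos c * cos c) < / (t * t - c * c)).
{ apply Rinv_lt_contravar; [|lra].
  assert (0 < t * t - c * c) by nra; nra. }
assert (0 < t * (/ (t * t - c * c) - / (cos c * cos c))) by nra; nra.
Qed.

Lemma gap_decreasing (t a b : R) : 0 <= a < b -> b < t < PI / 2 ->
  b * b + cos b * cos b <= t * t -> gap t b < gap t a.
Proof.
intros Ha Hb Hq; destruct (gap_MVT t a b Ha Hb) as (c & Hc & E).
pose proof (sqr_plus_cos_sqr_increasing c b ltac:(lra)).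
assert (0 < cos c) by (apply cos_gt_0; lra).
assert (/ (t * t - c * c) < / (cos c * cos c)).
{ apply Rinv_lt_contravar; [|lra].
  apply Rmult_lt_0_compat; nra. }
assert (t * (/ (t * t - c * c) - / (cos c * cos c)) < 0) by nra; nra.
Qed.

(** * The positive fixed point and its dependence on the parameter *)

Lemma continuous_tanh (y : R) : continuous tanh y.
Proof.
apply (ex_derive_continuous tanh); unfold tanh, sinh, cosh; auto_derive.
pose proof (exp_pos y); pose proof (exp_pos (- y)); lra.
Qed.

Lemma continuous_tanh_tan_param (x t : R) : continuous (fun s => s * tanh (s * tan x)) t.
Proof.
apply (continuous_mult (fun s : R => s)); [apply continuous_id|].
apply (continuous_comp (fun s => s * tan x) tanh); [|apply continuous_tanh].
apply (continuous_mult (fun s : R => s)); [apply continuous_id | apply continuous_const].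
Qed.

Lemma continuous_tanh_tan (t x : R) : cos x <> 0 -> continuous (fun u => t * tanh (t * tan u)) x.
Proof.
intros Hx; apply (continuous_mult (fun _ : R => t)); [apply continuous_const|].
apply (continuous_comp (fun u => t * tan u) tanh); [|apply continuous_tanh].
apply (continuous_mult (fun _ : R => t)); [apply continuous_const | now apply continuous_tan].
Qed.

(** The inequality on t^2 is the attraction condition. The last two clauses give uniqueness and trap
    the point; reaching up to [PI / 2] rather than [t] lets one test point serve all nearby
    parameters. *)
Definition crossing (t x : R) : Prop :=
  0 < x < t /\ t * tanh (t * tan x) = x /\ t * t < x * x + cos x * cos x /\
  (forall u, 0 < u < x -> u < t * tanh (t * tan u)) /\
  (forall u, x < u < PI / 2 -> t * tanh (t * tan u) < u).

Lemma crossing_exists (t : R) : 1 < t < PI / 2 -> exists x, crossing t x.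
Proof.
intros Ht.
assert (Hcos : forall u, 0 <= u <= t -> 0 < cos u) by (intros; apply cos_gt_0; lra).
(* [x0] is the minimum of [gap t]; the end values are 1 - t^2 < 0 and cos^2 t > 0. *)
destruct (Ranalysis5.IVT_interv (fun u => u * u + cos u * cos u - t * t) 0 t)
  as (x0 & Hx0 & E0).
{ intros u _; apply continuity_pt_filterlim.
  apply (ex_derive_continuous (fun u => u * u + cos u * cos u - t * t)); auto_derive; auto. }
{ lra. }
{ rewrite cos_0; nra. }
{ pose proof (Hcos t ltac:(lra)); nra. }
assert (P0 : 0 < x0).
{ destruct (Req_dec x0 0) as [E | N]; [|lra]. rewrite E, cos_0 in E0; nra. }
assert (L0 : x0 < t).
{ destruct (Req_dec x0 t) as [E | N]; [|lra]. subst x0; pose proof (Hcos t ltac:(lra)); nra. }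
assert (G0 : gap t x0 < 0).
{ rewrite <- (gap_0 t); apply gap_decreasing; lra. }
assert (Gt : forall y, t * tanh y < t) by (intros y; pose proof (tanh_lt_1 y); nra).
(* The fixed-point equation replaces [gap] here: artanh(x/t) blows up at x = t, whereas tanh < 1
   settles the sign at that end. *)
destruct (Ranalysis5.IVT_interv (fun u => u - t * tanh (t * tan u)) x0 t)
  as (x & Hx & E).
{ intros u Hu; apply continuity_pt_filterlim.
  apply (continuous_minus (fun u : R => u) (fun u => t * tanh (t * tan u))); [apply continuous_id|].
  apply continuous_tanh_tan; pose proof (Hcos u ltac:(lra)); lra. }
{ lra. }
{ pose proof (gap_neg t x0 ltac:(lra) G0); lra. }
{ pose proof (Gt (t * tan t)); lra. }
assert (Lx : x < t) by (pose proof (Gt (t * tan x)); lra).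
assert (Gx : gap t x = 0) by (apply gap_root; lra).
assert (Px : x0 < x).
{ destruct (Req_dec x0 x) as [-> | N]; lra. }
pose proof (sqr_plus_cos_sqr_increasing x0 x ltac:(lra)) as Qx.
exists x; repeat split; try lra.
(* Up to [x0], [gap] falls from 0; from [x0] to [x] it climbs back to 0. *)
- intros u Hu; apply gap_neg; [lra|].
  destruct (Rle_or_lt u x0) as [L | L].
  + rewrite <- (gap_0 t); apply gap_decreasing; try lra.
    destruct (Req_dec u x0) as [-> | N]; [lra|].
    pose proof (sqr_plus_cos_sqr_increasing u x0 ltac:(lra)); lra.
  + rewrite <- Gx; apply gap_increasing; try lra.
    pose proof (sqr_plus_cos_sqr_increasing x0 u ltac:(lra)); lra.
- intros u Hu; destruct (Rle_or_lt t u) as [L | L].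
  + pose proof (Gt (t * tan u)); lra.
  + apply gap_pos; [lra|]. rewrite <- Gx; apply gap_increasing; lra.
Qed.

(** At t = 1 the decreasing phase of [gap] is empty, since x^2 + cos^2 x already equals 1 at 0. No
    positive fixed point remains, which drives the cycle to 0. *)
Lemma tanh_tan_lt (x : R) : 0 < x < PI / 2 -> 1 * tanh (1 * tan x) < x.
Proof.
intros Hx; destruct (Rle_or_lt 1 x) as [L | L].
- pose proof (tanh_lt_1 (1 * tan x)); lra.
- apply gap_pos; [lra|]. rewrite <- (gap_0 1).
  pose proof PI2_1; apply gap_increasing; try lra; rewrite cos_0; lra.
Qed.

Lemma crossing_gt (t x a : R) : crossing t x -> 0 < a < PI / 2 ->
  a < t * tanh (t * tan a) -> a < x.
Proof.
intros (_ & E & _ & _ & H) Ha L; destruct (Rtotal_order a x) as [?|[->|G]]; auto; [lra|].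
specialize (H a); lra.
Qed.

Lemma crossing_lt (t x b : R) : crossing t x -> 0 < b < PI / 2 ->
  t * tanh (t * tan b) < b -> x < b.
Proof.
intros (_ & E & _ & H & _) Ha L; destruct (Rtotal_order b x) as [G|[->|?]]; auto; [|lra].
specialize (H b); lra.
Qed.

(** The strict signs at test points a < x < b persist for nearby parameters and trap the crossing
    between them. *)
Lemma crossing_continuous (xs : R -> R) (t : R) :
  (forall s, 1 < s < PI / 2 -> crossing s (xs s)) ->
  1 < t < PI / 2 -> continuous xs t.
Proof.
intros Hxs Ht; apply filterlim_locally; intros [e He].
pose proof (Hxs t Ht) as Hc; destruct Hc as ([P L] & _ & _ & Hl & Hr).
set (x := xs t) in *.
(* The clipping by [x / 2] and by the midpoint of [x] and [PI / 2] keeps both test points inside (0,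
   PI/2). *)
set (a := Rmax (x - e / 2) (x / 2)); set (b := Rmin (x + e / 2) ((x + PI / 2) / 2)).
assert (Ha : x - e / 2 <= a /\ 0 < a < x).
{ unfold a; repeat split; [apply Rmax_l | eapply Rlt_le_trans; [|apply Rmax_r]; lra |].
  apply Rmax_lub_lt; lra. }
assert (Hb : b <= x + e / 2 /\ x < b < PI / 2).
{ unfold b; repeat split; [apply Rmin_l | apply Rmin_glb_lt; lra |].
  eapply Rle_lt_trans; [apply Rmin_r|]; lra. }
assert (Ea : locally t (fun s => a < s * tanh (s * tan a))).
{ apply (continuous_tanh_tan_param a t (fun y => a < y)), open_gt, Hl; lra. }
assert (Eb : locally t (fun s => s * tanh (s * tan b) < b)).
{ apply (continuous_tanh_tan_param b t (fun y => y < b)), open_lt, Hr; lra. }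
assert (Et : locally t (fun s => 1 < s < PI / 2)).
{ apply filter_and; [apply (open_gt 1) | apply (open_lt (PI / 2))]; lra. }
refine (filter_imp _ _ _ (filter_and _ _ Et (filter_and _ _ Ea Eb))).
intros s (Hs & Hsa & Hsb).
pose proof (crossing_gt s (xs s) a (Hxs s Hs) ltac:(lra) Hsa).
pose proof (crossing_lt s (xs s) b (Hxs s Hs) ltac:(lra) Hsb).
change (Rabs (xs s - x) < e); apply Rabs_def1; lra.
Qed.

Lemma crossing_lim_1 (xs : R -> R) :
  (forall t, 1 < t < PI / 2 -> crossing t (xs t)) ->
  filterlim xs (at_right 1) (locally 0).
Proof.
intros Hxs; apply filterlim_locally; intros [e He].
set (b := Rmin e 1).
pose proof PI2_1.
assert (Hb : b <= e /\ 0 < b <= 1).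
{ unfold b; repeat split; [apply Rmin_l | apply Rmin_glb_lt; lra | apply Rmin_r]. }
assert (Eb : locally 1 (fun s => s * tanh (s * tan b) < b)).
{ apply (continuous_tanh_tan_param b 1 (fun y => y < b)), open_lt, tanh_tan_lt; lra. }
assert (Et : locally 1 (fun s => s < PI / 2)) by (apply (open_lt (PI / 2)); lra).
unfold at_right, within.
refine (filter_imp _ _ _ (filter_and _ _ Et Eb)).
intros s (Hs & Hsb) Hs1.
assert (Hc : crossing s (xs s)) by (apply Hxs; lra).
pose proof (crossing_lt s (xs s) b Hc ltac:(lra) Hsb).
destruct Hc as ([P _] & _).
change (Rabs (xs s - 0) < e); apply Rabs_def1; lra.
Qed.

Local Open Scope C_scope.

(** * Complex derivative of [T t] *)

(* The product and chain rules are stated for [AbsRing_NormedModule C_AbsRing],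
   while [is_multiplier] uses [C_NormedModule]; [is_derive_C_normed] goes between
   the two. *)
Local Notation is_C_derive f z l :=
  (@is_derive C_AbsRing (AbsRing_NormedModule C_AbsRing) f (z : C) (l : C)).

(** [is_derive] quantifies over all limits of the neighbourhood filter of [z]; uniqueness leaves
    only [z], and h = w - z gives the usual increment. *)
Lemma is_derive_C_eps (f : C -> C) (z l : C) :
  (forall eps : posreal, exists d : posreal, forall h : C, Cmod h < d ->
     Cmod (f (z + h) - f z - h * l)%C <= eps * Cmod h)%R ->
  is_C_derive f z l.
Proof.
intros H; split.
- apply (is_linear_scal_l (K := C_AbsRing)).
- intros y Hy.
  apply (is_filter_lim_locally_unique (K := C_AbsRing) (V := AbsRing_NormedModule C_AbsRing)) in Hy.
  subst y.
  intros eps; destruct (H eps) as [d Hd].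
  exists d; intros w Hw.
  change C in w.
  specialize (Hd (w - z)%C Hw).
  replace (z + (w - z))%C with w in Hd by ring.
  exact Hd.
Qed.

Lemma is_derive_C_normed (f : C -> C) (z l : C) :
  is_C_derive f z l <->
  is_derive (K := C_AbsRing) (V := C_NormedModule) f z l.
Proof.
split; intros [[L1 L2 L3] H]; (split; [split; [exact L1 | exact L2 | exact L3] | exact H]).
Qed.

Lemma is_derive_R_eps (f : R -> R) (l : R) (eps : posreal) :
  is_derive f 0 l -> exists d : posreal, forall h : R, (Rabs h < d ->
     Rabs (f h - f 0 - h * l) <= eps * Rabs h)%R.
Proof.
intros [_ H]; destruct (H 0%R (fun P HP => HP) eps) as [d Hd].
exists d; intros h Hh.
assert (B : ball (0:R_UniformSpace) d h).
{ change (Rabs (h - 0) < d)%R; now rewrite Rminus_0_r. }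
specialize (Hd h B).
change (Rabs ((f h - f 0) - (h - 0) * l) <= eps * Rabs (h - 0))%R in Hd.
now rewrite Rminus_0_r in Hd.
Qed.

(** * Differentiability of the complex exponential at 0 *)

Lemma Cexp_0 : Cexp 0 = 1.
Proof.
unfold Cexp; simpl; rewrite exp_0, cos_0, sin_0.
unfold RtoC; f_equal; ring.
Qed.

Lemma Cexp_plus (z w : C) : Cexp (z + w) = Cexp z * Cexp w.
Proof.
unfold Cexp; destruct z as [a b], w as [c d]; simpl.
rewrite exp_plus, cos_plus, sin_plus.
unfold Cmult; simpl; f_equal; ring.
Qed.

Lemma Cmod_le_sum (a b : R) : (Cmod (a, b) <= Rabs a + Rabs b)%R.
Proof.
replace (a, b) with (RtoC a + Ci * RtoC b)%C.
- eapply Rle_trans; [apply Cmod_triangle|].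
  rewrite Cmod_mult, Cmod_Ci, !Cmod_R; lra.
- unfold Cplus, Cmult, RtoC, Ci; simpl; f_equal; ring.
Qed.

Lemma is_derive_Cexp_0 : is_C_derive Cexp 0 1.
Proof.
apply is_derive_C_eps; intros eps.
(* The five error terms below total at most 7 k |h|, hence eps / 8; the cap 1 gives |1 + a| <= 2. *)
assert (Hk : (0 < Rmin (eps / 8) 1)%R).
{ destruct eps as [e He]; simpl; apply Rmin_pos; lra. }
assert (exists e : posreal, (e <= eps / 8 /\ e <= 1)%R) as (e & He8 & He1).
{ exists (mkposreal _ Hk); split; [apply Rmin_l | apply Rmin_r]. }
clear Hk; pose proof (cond_pos e) as He.
destruct (is_derive_R_eps exp 1 e) as [d1 H1].
{ auto_derive; auto; rewrite exp_0; ring. }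
destruct (is_derive_R_eps cos 0 e) as [d2 H2].
{ auto_derive; auto; rewrite sin_0; ring. }
destruct (is_derive_R_eps sin 1 e) as [d3 H3].
{ auto_derive; auto; rewrite cos_0; ring. }
assert (Hd : (0 < Rmin (Rmin d1 d2) (Rmin d3 e))%R).
{ apply Rmin_pos; apply Rmin_pos; first [apply cond_pos | exact He]. }
exists (mkposreal _ Hd); intros [a b] Hh; simpl in Hh.
pose proof (Rmax_Cmod (a, b)) as HM; simpl in HM.
pose proof (Rmax_l (Rabs a) (Rabs b)); pose proof (Rmax_r (Rabs a) (Rabs b)).
pose proof (Rmin_l (Rmin d1 d2) (Rmin d3 e)); pose proof (Rmin_r (Rmin d1 d2) (Rmin d3 e)).
pose proof (Rmin_l d1 d2); pose proof (Rmin_r d1 d2).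
pose proof (Rmin_l d3 e); pose proof (Rmin_r d3 e).
set (m := Cmod (a, b)) in *.
specialize (H1 a ltac:(lra)); specialize (H2 b ltac:(lra)); specialize (H3 b ltac:(lra)).
rewrite exp_0 in H1; rewrite cos_0 in H2; rewrite sin_0 in H3.
rewrite Rmult_1_r in H1, H3; rewrite Rmult_0_r, Rminus_0_r in H2; rewrite Rminus_0_r in H3.
set (k := pos e) in *.
assert (Ha : (Rabs a <= m)%R) by lra; assert (Hb : (Rabs b <= m)%R) by lra.
assert (Hm : (0 <= m)%R) by (pose proof (Rabs_pos a); lra).
rewrite Cplus_0_l, Cexp_0.
(* Each component is split into the real first-order errors of exp, cos and sin at 0, plus the
   quadratic term a b. *)
replace (Cexp (a, b) - 1 - (a, b) * 1)%C with
  ((exp a - 1 - a) * cos b + (1 + a) * (cos b - 1),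
   (exp a - 1 - a) * sin b + (1 + a) * (sin b - b) + a * b)%R.
2:{ unfold Cexp, Cminus, Cplus, Copp, Cmult, RtoC; simpl; f_equal; ring. }
assert (P : forall u v A B : R, (Rabs u <= A -> Rabs v <= B -> Rabs (u * v) <= A * B)%R).
{ intros u v A B Hu Hv; rewrite Rabs_mult; apply Rmult_le_compat; auto using Rabs_pos. }
assert (H1a : (Rabs (1 + a) <= 2)%R).
{ eapply Rle_trans; [apply Rabs_triang|]; rewrite Rabs_R1; lra. }
assert (E1 : (Rabs (exp a - 1 - a) <= k * m)%R) by (eapply Rle_trans; [exact H1|]; nra).
assert (E2 : (Rabs (cos b - 1) <= k * m)%R) by (eapply Rle_trans; [exact H2|]; nra).
assert (E3 : (Rabs (sin b - b) <= k * m)%R) by (eapply Rle_trans; [exact H3|]; nra).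
assert (Hc : (Rabs (cos b) <= 1)%R) by (apply Rabs_le, COS_bound).
assert (Hs : (Rabs (sin b) <= 1)%R) by (apply Rabs_le, SIN_bound).
assert (Hbk : (Rabs b <= k)%R) by lra.
pose proof (P _ _ _ _ E1 Hc); pose proof (P _ _ _ _ E1 Hs).
pose proof (P _ _ _ _ H1a E2); pose proof (P _ _ _ _ H1a E3); pose proof (P _ _ _ _ Ha Hbk).
eapply Rle_trans; [apply Cmod_le_sum|].
eapply Rle_trans.
{ apply Rplus_le_compat; [apply Rabs_triang|].
  eapply Rle_trans; [apply Rabs_triang | apply Rplus_le_compat_r, Rabs_triang]. }
apply Rle_trans with (8 * k * m)%R; [|nra].
assert (0 <= k * m)%R by nra; lra.
Qed.

(** * Differentiation rules and the derivative of the tangent *)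

Lemma is_C_derive_eq (f : C -> C) (z l l' : C) :
  is_C_derive f z l -> l = l' -> is_C_derive f z l'.
Proof. now intros H <-. Qed.

Lemma is_C_derive_const (a z : C) : is_C_derive (fun _ => a) z (RtoC 0).
Proof. apply (is_derive_const (K := C_AbsRing) (V := AbsRing_NormedModule C_AbsRing)). Qed.

Lemma is_C_derive_id (z : C) : is_C_derive (fun w => w) z (RtoC 1).
Proof. apply (is_derive_id (K := C_AbsRing)). Qed.

Lemma is_C_derive_plus (f g : C -> C) (z l m : C) :
  is_C_derive f z l -> is_C_derive g z m ->
  is_C_derive (fun w => f w + g w) z (l + m).
Proof. apply (is_derive_plus (K := C_AbsRing) (V := AbsRing_NormedModule C_AbsRing)). Qed.

Lemma is_C_derive_minus (f g : C -> C) (z l m : C) :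
  is_C_derive f z l -> is_C_derive g z m ->
  is_C_derive (fun w => f w - g w) z (l - m).
Proof. apply (is_derive_minus (K := C_AbsRing) (V := AbsRing_NormedModule C_AbsRing)). Qed.

Lemma is_C_derive_opp (f : C -> C) (z l : C) :
  is_C_derive f z l -> is_C_derive (fun w => - f w) z (- l).
Proof. apply (is_derive_opp (K := C_AbsRing) (V := AbsRing_NormedModule C_AbsRing)). Qed.

Lemma is_C_derive_mult (f g : C -> C) (z l m : C) :
  is_C_derive f z l -> is_C_derive g z m ->
  is_C_derive (fun w => f w * g w) z (l * g z + f z * m).
Proof. intros Hf Hg; apply (is_derive_mult (K := C_AbsRing) f g); auto; apply Cmult_comm. Qed.

Lemma is_C_derive_comp (f g : C -> C) (z l m : C) :
  is_C_derive f (g z) l -> is_C_derive g z m ->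
  is_C_derive (fun w => f (g w)) z (m * l).
Proof. apply (is_derive_comp (K := C_AbsRing) (V := AbsRing_NormedModule C_AbsRing) f g). Qed.

(** The addition formula Cexp w = Cexp z Cexp (w - z) carries the derivative at 0 to [z]. *)
Lemma is_derive_Cexp (z : C) : is_C_derive Cexp z (Cexp z).
Proof.
apply (is_derive_ext (K := C_AbsRing) (V := AbsRing_NormedModule C_AbsRing)
  (fun w : C => Cexp z * Cexp (w - z))).
{ intros w; change C in w; rewrite <- Cexp_plus; f_equal; ring. }
eapply is_C_derive_eq.
- apply is_C_derive_mult; [apply is_C_derive_const|].
  apply (is_C_derive_comp Cexp (fun w => w - z)).
  + replace (z - z)%C with (RtoC 0) by ring; apply is_derive_Cexp_0.
  + apply is_C_derive_minus; [apply is_C_derive_id | apply is_C_derive_const].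
- simpl; ring.
Qed.

Lemma is_derive_Cinv (z : C) : z <> 0 ->
  is_C_derive Cinv z (- / (z * z)).
Proof.
intros Hz; apply is_derive_C_eps; intros eps.
assert (Hr : (0 < Cmod z)%R) by now apply Cmod_gt_0.
set (r := Cmod z) in *.
(* The remainder is h^2 / (z^2 (z + h)). The first bound keeps |z + h| above r / 2, and the second
   then makes the remainder at most eps |h|. *)
assert (Hd : (0 < Rmin (r / 2) (eps * r ^ 3 / 2))%R).
{ apply Rmin_pos; [lra|]. pose proof (cond_pos eps).
  apply Rdiv_lt_0_compat; [|lra]. apply Rmult_lt_0_compat; [lra|now apply pow_lt]. }
exists (mkposreal _ Hd); intros h Hh; change (Cmod h < Rmin (r / 2) (eps * r ^ 3 / 2))%R in Hh.
pose proof (Rmin_l (r / 2) (eps * r ^ 3 / 2)); pose proof (Rmin_r (r / 2) (eps * r ^ 3 / 2)).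
assert (Hzh : (r / 2 < Cmod (z + h))%R).
{ assert (r <= Cmod (z + h) + Cmod h)%R.
  { unfold r; replace z with ((z + h) + - h)%C at 1 by ring.
    rewrite <- (Cmod_opp h); apply Cmod_triangle. }
  lra. }
assert (Hzh0 : z + h <> 0) by (apply Cmod_gt_0; lra).
replace (/ (z + h) - / z - h * - / (z * z))%C with (h * h / (z * z * (z + h)))%C by (field; auto).
assert (Hzz : z * z * (z + h) <> 0) by (repeat apply Cmult_neq_0; auto).
rewrite Cmod_div, !Cmod_mult by auto; fold r.
apply Rle_div_l; [repeat apply Rmult_lt_0_compat; lra|].
pose proof (Cmod_ge_0 h); pose proof (cond_pos eps).
replace (eps * Cmod h * (r * r * Cmod (z + h)))%R
  with (Cmod h * (eps * r * r * Cmod (z + h)))%R by ring.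
apply Rmult_le_compat_l; [assumption|].
assert (0 < eps * r * r)%R by (repeat apply Rmult_lt_0_compat; lra).
apply Rle_trans with (eps * r * r * (r / 2))%R; [lra|].
apply Rmult_le_compat_l; lra.
Qed.

Lemma Ci_sqr : Ci * Ci = - (1).
Proof. unfold Ci, Cmult, RtoC, Copp; simpl; f_equal; ring. Qed.

Lemma Ci_neq_0 : Ci <> 0.
Proof. intros E; injection E; intros; lra. Qed.

Lemma Csin2_plus_Ccos2 (z : C) : Csin z * Csin z + Ccos z * Ccos z = 1.
Proof.
unfold Csin, Ccos.
(* As i^2 = -1, the sum is ((e + e')^2 - (e - e')^2) / 4 = e e'. *)
transitivity (Cexp (Ci * z) * Cexp (- (Ci * z))).
2:{ rewrite <- Cexp_plus, Cplus_opp_r; apply Cexp_0. }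
set (e := Cexp (Ci * z)); set (e' := Cexp (- (Ci * z))).
replace ((e - e') / (2 * Ci) * ((e - e') / (2 * Ci)))%C
  with ((e - e') * (e - e') / (4 * (Ci * Ci)))%C by (field; apply Ci_neq_0).
rewrite Ci_sqr; field; split; intros E; injection E; intros; lra.
Qed.

Lemma is_derive_Ccos (z : C) : is_C_derive Ccos z (- Csin z).
Proof.
unfold Ccos, Csin.
eapply is_C_derive_eq.
- apply is_C_derive_mult; [apply is_C_derive_plus|apply is_C_derive_const].
  + apply (is_C_derive_comp Cexp (fun w => Ci * w)); [apply is_derive_Cexp|].
    apply is_C_derive_mult; [apply is_C_derive_const|apply is_C_derive_id].
  + apply (is_C_derive_comp Cexp (fun w => - (Ci * w))); [apply is_derive_Cexp|].
    apply is_C_derive_opp, is_C_derive_mult; [apply is_C_derive_const|apply is_C_derive_id].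
- transitivity (Ci * Ci * ((Cexp (Ci * z) - Cexp (- (Ci * z))) / (2 * Ci))).
  + field; apply Ci_neq_0.
  + rewrite Ci_sqr; ring.
Qed.

Lemma is_derive_Csin (z : C) : is_C_derive Csin z (Ccos z).
Proof.
unfold Ccos, Csin.
eapply is_C_derive_eq.
- apply is_C_derive_mult; [apply is_C_derive_minus|apply is_C_derive_const].
  + apply (is_C_derive_comp Cexp (fun w => Ci * w)); [apply is_derive_Cexp|].
    apply is_C_derive_mult; [apply is_C_derive_const|apply is_C_derive_id].
  + apply (is_C_derive_comp Cexp (fun w => - (Ci * w))); [apply is_derive_Cexp|].
    apply is_C_derive_opp, is_C_derive_mult; [apply is_C_derive_const|apply is_C_derive_id].
- simpl; field; apply Ci_neq_0.
Qed.

Lemma is_derive_T (t : R) (z : C) : Ccos z <> 0 ->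
  is_C_derive (T t) z (Ci * t / (Ccos z * Ccos z)).
Proof.
intros Hz; unfold T, Ctan.
eapply is_C_derive_eq.
- apply is_C_derive_mult; [apply is_C_derive_const|].
  apply is_C_derive_mult; [apply is_derive_Csin|].
  apply (is_C_derive_comp Cinv Ccos); [now apply is_derive_Cinv | apply is_derive_Ccos].
- transitivity (Ci * t * (Csin z * Csin z + Ccos z * Ccos z) / (Ccos z * Ccos z)).
  + simpl; field; exact Hz.
  + rewrite Csin2_plus_Ccos2; field; exact Hz.
Qed.

(** * Values on the real and imaginary axes *)

Lemma Ccos_real (x : R) : Ccos (x, 0%R) = (cos x, 0%R).
Proof.
unfold Ccos, Cexp, Ci, Cdiv, Cinv, Cmult, Cplus, Copp, RtoC; simpl.
replace (0 * x - 1 * 0)%R with 0%R by ring.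
replace (0 * 0 + 1 * x)%R with x by ring.
rewrite Ropp_0, exp_0, cos_neg, sin_neg; f_equal; field.
Qed.

Lemma Csin_real (x : R) : Csin (x, 0%R) = (sin x, 0%R).
Proof.
unfold Csin, Cexp, Ci, Cdiv, Cinv, Cminus, Cmult, Cplus, Copp, RtoC; simpl.
replace (0 * x - 1 * 0)%R with 0%R by ring.
replace (0 * 0 + 1 * x)%R with x by ring.
rewrite Ropp_0, exp_0, cos_neg, sin_neg; f_equal; field.
Qed.

Lemma Ccos_imag (y : R) : Ccos (0%R, y) = (cosh y, 0%R).
Proof.
unfold Ccos, Cexp, Ci, Cdiv, Cinv, Cmult, Cplus, Copp, RtoC, cosh; simpl.
replace (0 * 0 - 1 * y)%R with (- y)%R by ring.
replace (0 * y + 1 * 0)%R with 0%R by ring.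
rewrite Ropp_involutive, Ropp_0, cos_0, sin_0; f_equal; field.
Qed.

Lemma Csin_imag (y : R) : Csin (0%R, y) = (0%R, sinh y).
Proof.
unfold Csin, Cexp, Ci, Cdiv, Cinv, Cminus, Cmult, Cplus, Copp, RtoC, sinh; simpl.
replace (0 * 0 - 1 * y)%R with (- y)%R by ring.
replace (0 * y + 1 * 0)%R with 0%R by ring.
rewrite Ropp_involutive, Ropp_0, cos_0, sin_0; f_equal; field.
Qed.

Lemma T_real (t x : R) : cos x <> 0%R -> T t (x, 0%R) = (0%R, (t * tan x)%R).
Proof.
intros H; unfold T, Ctan; rewrite Ccos_real, Csin_real.
unfold Ci, Cdiv, Cinv, Cmult, RtoC, tan; simpl; f_equal; field; auto.
Qed.

Lemma T_imag (t y : R) : T t (0%R, y) = ((- (t * tanh y))%R, 0%R).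
Proof.
assert (H : cosh y <> 0%R) by (unfold cosh; pose proof (exp_pos y); pose proof (exp_pos (- y)); lra).
unfold T, Ctan; rewrite Ccos_imag, Csin_imag.
unfold Ci, Cdiv, Cinv, Cmult, RtoC, tanh; simpl; f_equal; field; auto.
Qed.

(** Every point of the cycle has a real cosine, cos x or cosh y, so one formula covers both axes. *)
Lemma Cmod_derive_T (t r : R) (z : C) : (0 < t)%R -> r <> 0%R -> Ccos z = (r, 0%R) ->
  Cmod (Ci * t / (Ccos z * Ccos z)) = (t / (r * r))%R.
Proof.
intros Ht Hr ->; change (r, 0%R) with (RtoC r).
assert (Hr' : RtoC r <> 0) by (intros E; injection E; auto).
rewrite Cmod_div by now apply Cmult_neq_0.
rewrite !Cmod_mult, Cmod_Ci, !Cmod_R, <- Rabs_mult, (Rabs_pos_eq t), (Rabs_pos_eq (r * r)) by nra.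
now rewrite Rmult_1_l.
Qed.

(** * The 4-cycle *)

Lemma filterlim_C {U : Type} (F : (U -> Prop) -> Prop) {FF : Filter F} (u v : U -> R) (a b : R) :
  filterlim u F (locally a) -> filterlim v F (locally b) ->
  filterlim (fun s => (u s, v s) : C) F (locally ((a, b) : C)).
Proof.
intros Hu Hv; apply filterlim_locally; intros e.
apply filterlim_locally with (eps := e) in Hu; apply filterlim_locally with (eps := e) in Hv.
refine (filter_imp _ _ _ (filter_and _ _ Hu Hv)).
intros s Hs; exact Hs.
Qed.

(** Two steps of [T t] act on the real axis as minus the map x -> t tanh (t tan x), so by oddness
    the orbit of a fixed point of that map closes after four steps. *)
Definition axis_cycle (t x : R) (i : nat) : C :=
  match i with
  | 0%nat => (x, 0%R)
  | 1%nat => (0%R, (t * tan x)%R)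
  | 2%nat => ((- x)%R, 0%R)
  | _ => (0%R, (- (t * tan x))%R)
  end.

Lemma axis_cycle_is_cycle (t x : R) : (0 < t)%R -> (0 < x < PI / 2)%R ->
  (t * tanh (t * tan x) = x)%R -> is_cycle t 4 (axis_cycle t x).
Proof.
intros Ht Hx E.
assert (Hc : (0 < cos x)%R) by (apply cos_gt_0; lra).
assert (Hy : (0 < t * tan x)%R) by (apply Rmult_lt_0_compat; [lra | apply tan_gt_0; lra]).
pose proof (cosh_pos (t * tan x)).
split; [lia | split].
- intros i j Hi Hj; destruct i as [|[|[|[|i]]]]; try lia; destruct j as [|[|[|[|j]]]]; try lia;
    simpl; intros H0; try reflexivity; injection H0; intros; lra.
- intros i Hi; destruct i as [|[|[|[|i]]]]; try lia; simpl;
    rewrite ?Ccos_real, ?Ccos_imag, ?cos_neg, ?cosh_opp;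
    (split; [intros H0; injection H0; intros; lra|]).
  + apply T_real; lra.
  + now rewrite T_imag, E.
  + rewrite T_real by (rewrite cos_neg; lra).
    rewrite tan_neg; f_equal; ring.
  + rewrite T_imag, tanh_opp; f_equal; lra.
Qed.

(** With y = t tan x, the multiplier has modulus k^2 for k = t^2 / (cos^2 x cosh^2 y). Since t^2 /
    cosh^2 y = t^2 - x^2, k < 1 is the inequality in [crossing]. *)
Lemma axis_cycle_attracting (t x : R) : (1 < t < PI / 2)%R -> crossing t x ->
  is_attracting_cycle t 4 (axis_cycle t x).
Proof.
intros Ht (Hx & E & Q & _).
assert (Cy : is_cycle t 4 (axis_cycle t x)) by (apply axis_cycle_is_cycle; lra).
split; [exact Cy|].
destruct Cy as (_ & _ & Cy).
destruct (Cy 0%nat ltac:(lia)) as [C0 T0]; destruct (Cy 1%nat ltac:(lia)) as [C1 T1];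
destruct (Cy 2%nat ltac:(lia)) as [C2 T2]; destruct (Cy 3%nat ltac:(lia)) as [C3 _].
simpl Nat.modulo in T0, T1, T2.
eexists; split.
- apply is_derive_C_normed; unfold Nat.iter, nat_rect.
  (* The chain rule peels off the outermost map, whose derivative is taken at the last point of the
     orbit. *)
  apply (is_C_derive_comp (T t) (fun w => T t (T t (T t w)))).
  { rewrite T0, T1, T2; now apply is_derive_T. }
  apply (is_C_derive_comp (T t) (fun w => T t (T t w))).
  { rewrite T0, T1; now apply is_derive_T. }
  apply (is_C_derive_comp (T t) (T t)).
  { rewrite T0; now apply is_derive_T. }
  now apply is_derive_T.
- assert (Hc : (0 < cos x)%R) by (apply cos_gt_0; lra).
  set (y := (t * tan x)%R) in *; pose proof (cosh_pos y) as Hy.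
  rewrite !Cmod_mult.
  rewrite (Cmod_derive_T t (cos x)) by (try apply Ccos_real; lra).
  rewrite (Cmod_derive_T t (cosh y)) by (try apply Ccos_imag; lra).
  (* The two remaining points are the negatives of the first two and have the same cosines. *)
  rewrite (Cmod_derive_T t (cos x))
    by (try (simpl; rewrite Ccos_real, cos_neg; reflexivity); lra).
  rewrite (Cmod_derive_T t (cosh y))
    by (try (simpl; fold y; rewrite Ccos_imag, cosh_opp; reflexivity); lra).
  set (k := (t * t / (cos x * cos x * (cosh y * cosh y)))%R).
  replace (_ * _)%R with (k * k)%R by (unfold k; field; split; lra).
  assert (D : (0 < cos x * cos x * (cosh y * cosh y))%R) by (apply Rmult_lt_0_compat; nra).
  assert (Hk0 : (0 < k)%R) by (apply Rdiv_lt_0_compat; nra).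
  assert (Hk1 : (k < 1)%R); [|nra].
  apply Rlt_div_l; [exact D|]; rewrite Rmult_1_l.
  assert (S : (cosh y * cosh y * (t * t - x * x) = t * t)%R).
  { replace (t * t - x * x)%R with (t * t * (1 - tanh y * tanh y))%R by (rewrite <- E; ring).
    pose proof (cosh_sqr_tanh y); nra. }
  assert (0 < cosh y * cosh y)%R by nra.
  nra.
Qed.

(** * The fixed point 0 *)

Lemma Ccos_0 : Ccos 0 = (1%R, 0%R).
Proof. unfold RtoC; rewrite Ccos_real, cos_0; reflexivity. Qed.

Lemma T_0 (t : R) : T t 0 = 0.
Proof.
unfold RtoC; rewrite T_real by (rewrite cos_0; lra).
rewrite tan_0; f_equal; ring.
Qed.

Lemma multiplier_0 (t : R) : is_multiplier t 1 (fun _ => RtoC 0) (Ci * t / (Ccos 0 * Ccos 0)).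
Proof.
apply is_derive_C_normed, is_derive_T.
rewrite Ccos_0; intros E; injection E; intros; lra.
Qed.

(** Uniqueness of the derivative turns the relation into a value, which is what refutes repulsion
    for t <= 1. *)
Lemma Cmod_multiplier_0 (t : R) (m : C) : (0 < t)%R ->
  is_multiplier t 1 (fun _ => RtoC 0) m -> Cmod m = t.
Proof.
intros Ht Hm.
apply is_C_derive_unique in Hm; rewrite <- Hm.
rewrite (is_C_derive_unique _ _ _ (multiplier_0 t)).
rewrite (Cmod_derive_T t 1) by (try apply Ccos_0; lra); field.
Qed.

(** That 0 becomes repelling is rendered by its not being so for t <= 1; persistence of the cycle,
    by continuity of its four points in the parameter. *)
Theorem lemma3p3 :
  (forall t : R, (0 < t <= 1)%R ->
     T t (RtoC 0) = RtoC 0 /\ ~ is_repelling_fixed_point t (RtoC 0)) /\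
  (forall t : R, (1 < t < PI / 2)%R -> is_repelling_fixed_point t (RtoC 0)) /\
  exists z : R -> nat -> C,
    (forall t : R, (1 < t < PI / 2)%R -> is_attracting_cycle t 4 (z t)) /\
    (forall i : nat, (i < 4)%nat ->
       (forall t : R, (1 < t < PI / 2)%R ->
          continuous (fun s : R => z s i) t) /\
       filterlim (fun t : R => z t i) (at_right 1%R) (locally (RtoC 0))).
Proof.
split; [|split].
- intros t Ht; split; [apply T_0|].
  intros (_ & m & Hm & Lm).
  rewrite (Cmod_multiplier_0 t m) in Lm by (auto; lra); lra.
- intros t Ht; split.
  + split; [lia | split; [intros; lia|]].
    intros i _; split; [|apply T_0].
    rewrite Ccos_0; intros E; injection E; intros; lra.
  + eexists; split; [apply multiplier_0|].
    rewrite (Cmod_multiplier_0 t) by (try apply multiplier_0; lra); lra.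
(* A pointwise choice suffices: [crossing] determines its point, and continuity follows from the
   trapping argument. *)
- set (xs := fun t => epsilon (inhabits 0%R) (crossing t)).
  assert (Hxs : forall t, (1 < t < PI / 2)%R -> crossing t (xs t)).
  { intros t Ht; now apply epsilon_spec, crossing_exists. }
  exists (fun t => axis_cycle t (xs t)); split.
  { intros t Ht; now apply axis_cycle_attracting, Hxs. }
  (* A general filter [F] serves both continuity at [t] and the limit at 1 from the right, where the
     limit cycle is [axis_cycle 1 0], all zeros. *)
  assert (L : forall (F : (R -> Prop) -> Prop) (t x : R), Filter F -> cos x <> 0%R ->
    filterlim (fun s => s) F (locally t) -> filterlim xs F (locally x) ->
    forall i, filterlim (fun s => axis_cycle s (xs s) i) F (locally (axis_cycle t x i))).
  { intros F t x FF Hc Ht Hx.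
    assert (Hy : filterlim (fun s => s * tan (xs s))%R F (locally (t * tan x)%R)).
    { apply (filterlim_comp_2 _ _ Rmult Ht (filterlim_comp _ _ _ _ _ _ _ _ Hx (continuous_tan x Hc))).
      apply (filterlim_mult t (tan x)). }
    intros [|[|[|i]]]; simpl; apply filterlim_C; auto; try apply filterlim_const.
    - apply (filterlim_comp _ _ _ _ _ _ _ _ Hx (filterlim_opp x)).
    - apply (filterlim_comp _ _ _ _ _ _ _ _ Hy (filterlim_opp (t * tan x)%R)). }
  intros i Hi; split.
  + intros t Ht; apply (L (locally t)); [apply locally_filter | |apply filterlim_id|].
    * destruct (Hxs t Ht) as [P _]; apply Rgt_not_eq, cos_gt_0; lra.
    * now apply crossing_continuous.
  + replace (RtoC 0) with (axis_cycle 1 0 i).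
    2:{ destruct i as [|[|[|[|i]]]]; try lia; simpl; rewrite ?tan_0, ?Rmult_0_r, ?Ropp_0; reflexivity. }
    apply L.
    * apply at_right_proper_filter.
    * rewrite cos_0; lra.
    * intros P HP; now apply filter_le_within.
    * now apply crossing_lim_1.
Qed.
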